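(* Let $G=(V,E)$ be a finite graph, let $x$ be a number, and let $w:2^E\to\mathbb{Q}_{\ge 0}$ satisfy $w(\emptyset)=0$ and $w(A)=\prod_{e\in A}w(e)$ for each $\emptyset\neq A\subseteq E$ (where $w(e)=w(\{e\})$), so that the connectivity augmented game $w(G)$ is a couple game. Let $a\in E$. Then the Shapley value of $a$ in $w(G)$ satisfies $$\phi_a(w(G))=(w(a)-1)\,B\bigl(G.a,x,(w(e))_{e\in E\setminus\{a\}}\bigr)+C(G.a,x),$$ where $G.a$ is $G$ with the edge $a$ contracted, $C$ is the chromatic polynomial and $B$ is the multivariate bad coloring polynomial.
   Context: Graphs are finite; loops and multiple edges are allowed. ''Number'' may be read as complex number. The symbol $\subseteq$ allows equality. Components and flats: for a graph $(V,E)$ and $A\subseteq E$, $c(A)$ is the number of connected components of $(V,A)$. A set $A\subseteq E$ is flat if $c(A)>c(A\cup\{e\})$ for every $e\in E\setminus A$. Games: a cooperative game with finite player set $N$ is a function $v:2^N\to\mathbb{C}$ with $v(\emptyset)=0$; here the players are the edges of $G$. For $R\subseteq N$ put $c_R(v)=\sum_{T\subseteq R}(-1)^{|R|-|T|}v(T)$. Connectivity augmentation: for $\emptyset\neq R\subseteq E$, the basic connectivity augmented game is $b(R,G,x)(S)=|R|x^{c(R)}$ if $R\subseteq S\subseteq E$, and $0$ otherwise. The connectivity augmented game of $w$ is $w(G)=\sum_{\emptyset\neq R\subseteq E}c_R(w)\,b(R,G,x)$. It is called a couple game when $w(A)=\prod_{e\in A}w(e)$ for all $\emptyset\ne A\subseteq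 E$. Shapley value: for a game $v$ on $N$ and a player $e\in N$, $\phi_e(v)=\sum_{e\in R\subseteq N}\frac{1}{|R|}c_R(v)$. Chromatic polynomial: for a graph $H=(V_H,E_H)$, $C(H,x)=\sum_{A\subseteq E_H}(-1)^{|A|}x^{c(A)}$, with $c(A)$ the number of connected components of $(V_H,A)$. Contraction: for $A\subseteq E$, $G.A$ is the graph whose vertices are the connected components of $(V,A)$ and which has exactly one edge for each $e\in E\setminus A$, joining the components containing the ends of $e$ (so loops and multiple edges may occur); the edge set of $G.A$ is identified with $E\setminus A$. We write $G.a=G.\{a\}$. Multivariate bad coloring polynomial: for a graph $H=(V_H,E_H)$, $B(H,x,(y_e)_{e\in E_H})=\sum_{A\subseteq E_H,\ A\text{ flat}}C(H.A,x)\prod_{e\in A}y_e$. *)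

(* Defs.v *)
From HB Require Import structures.
From mathcomp Require Import all_boot all_order all_algebra.

Set Implicit Arguments.
Unset Strict Implicit.
Unset Printing Implicit Defensive.

Import GRing.Theory.
Local Open Scope ring_scope.

(* Finite undirected multigraph.  The two ends of an edge are stored as an
   ordered pair, but no definition below depends on their order; an edge with
   equal ends is a loop, and edges sharing the same ends are parallel. *)
Record mgraph := MGraph {
  vertex : finType;
  edge : finType;
  ends : edge -> vertex * vertex }.

Section Components.
Variable G : mgraph.
Implicit Types (A : {set edge G}) (u v : vertex G).

Definition adj A : rel (vertex G) := fun u v =>
  [exists e in A, (ends e == (u, v)) || (ends e == (v, u))].

Definition component A v : {set vertex G} := [set u | connect (adj A) v u].

Definition components A : {set {set vertex G}} :=
  [set component A v | v in [set: vertex G]].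

Definition ncomp A : nat := #|components A|.

Definition flat A : bool :=
  [forall e, (e \notin A) ==> (ncomp (e |: A) < ncomp A)%N].

Lemma component_in A v : component A v \in components A.
Proof. by apply: imset_f; rewrite inE. Qed.

Definition component_vertex A v : {K : {set vertex G} | K \in components A} :=
  exist _ (component A v) (component_in A v).

(* The edge set of G.A is the subtype of edges outside A; [val] is the
   identification with E \ A. *)
Definition contract A : mgraph :=
  {| vertex := {K : {set vertex G} | K \in components A};
     edge := {e : edge G | e \notin A};
     ends := fun e => (component_vertex A (ends (val e)).1,
                       component_vertex A (ends (val e)).2) |}.

End Components.

Section Polynomials.
Variable F : fieldType.

(* The chromatic and bad coloring polynomials are given by their values. *)
Definition chromatic (H : mgraph) (x : F) : F :=
  \sum_(A : {set edge H}) (-1) ^+ #|A| * x ^+ ncomp A.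

Definition bad_coloring (H : mgraph) (x : F) (y : edge H -> F) : F :=
  \sum_(A : {set edge H} | flat A) chromatic (contract A) x * \prod_(e in A) y e.

End Polynomials.

Section Games.
Variables (F : fieldType) (N : finType).
Implicit Type v : {set N} -> F.

(* The coefficient c_R(v). *)
Definition dividend v (R : {set N}) : F :=
  \sum_(T : {set N} | T \subset R) (-1) ^+ (#|R| - #|T|) * v T.

Definition shapley v (e : N) : F :=
  \sum_(R : {set N} | e \in R) #|R|%:R^-1 * dividend v R.

End Games.

Section Augmentation.
Variables (F : fieldType) (G : mgraph) (x : F).

Definition basic_augmented_game (R S : {set edge G}) : F :=
  if R \subset S then #|R|%:R * x ^+ ncomp R else 0.

Definition augmented_game (w : {set edge G} -> F) (S : {set edge G}) : F :=
  \sum_(R : {set edge G} | R != set0) dividend w R * basic_augmented_game R S.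

End Augmentation.

(* Main.v *)
Require Import Defs.
From mathcomp Require Import all_boot all_order all_algebra.
From mathcomp Require Import reals complex.

Import GRing.Theory Num.Theory.
Local Open Scope ring_scope.
Local Open Scope complex_scope.

(** Write [y e] for [w [set e]].  The dividend of [augmented_game x w] at a
    nonempty [R] is [#|R| x^c(R) c_R(w)], and for a product game
    [c_R(w) = \prod_(e in R) (y e - 1) - (-1)^#|R|].  Splitting the Shapley
    value accordingly and writing [R = a |: R'] with [R'] a set of edges of
    [G.a], the signs give [C(G.a, x)] and the products give
    [(y a - 1) * \sum_(R') x^c(R') \prod_(e in R') (y e - 1)].
    For any graph this last sum equals the bad coloring polynomial: expanding
    each product over the subsets [A] of [R'] produces
    [\sum_A C(H.A, x) \prod_(e in A) y e], and the terms with [A] not flat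
    vanish because [H.A] then has a loop. *)

(** * Connectivity and component counts *)

Lemma adj_sym (G : mgraph) (A : {set edge G}) : symmetric (adj A).
Proof. by move=> u v; apply: eq_existsb => e; rewrite orbC. Qed.

Lemma connect_adj_sym (G : mgraph) (A : {set edge G}) :
  connect_sym (adj A).
Proof. exact: sym_connect_sym (@adj_sym G A). Qed.

Lemma component_eqE (G : mgraph) (A : {set edge G}) (u v : vertex G) :
  (component A u == component A v) = connect (adj A) u v.
Proof.
apply/eqP/idP => [/setP /(_ v)|uv]; first by rewrite !inE connect0.
by apply/setP => z; rewrite !inE (same_connect (@connect_adj_sym G A) uv).
Qed.

Lemma adj_ends {G : mgraph} (A : {set edge G}) (e : edge G) :
  e \in A -> adj A (ends e).1 (ends e).2.
Proof. by move=> eA; apply/exists_inP; exists e; rewrite // -surjective_pairing eqxx. Qed.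

Lemma adj_subrel {G : mgraph} {A B : {set edge G}} :
  A \subset B -> subrel (adj A) (adj B).
Proof.
move=> /subsetP AB u v /exists_inP[e eA E].
by apply/exists_inP; exists e => //; apply: AB.
Qed.

Lemma connect_adjS {G : mgraph} {A B : {set edge G}} :
  A \subset B -> subrel (connect (adj A)) (connect (adj B)).
Proof.
by move=> AB; apply: connect_sub => u v /(adj_subrel AB); apply: connect1.
Qed.

Lemma ncomp_eq (G : mgraph) (A B : {set edge G}) :
  connect (adj A) =2 connect (adj B) -> ncomp A = ncomp B.
Proof.
move=> AB; rewrite /ncomp /components; congr #|pred_of_set _|.
by apply: eq_imset => v; apply/setP => u; rewrite !inE AB.
Qed.

Lemma ncompU1_connected (G : mgraph) (A : {set edge G}) (e : edge G) :
  connect (adj A) (ends e).1 (ends e).2 -> ncomp (e |: A) = ncomp A.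
Proof.
move=> conn_e; apply: ncomp_eq => u v; apply/idP/idP; last first.
  by apply: connect_adjS; apply: subsetUr.
apply: connect_sub => {}u {}v /exists_inP[f].
rewrite !inE => /orP[/eqP-> | fA E].
  by case/orP => /eqP E; rewrite E // connect_adj_sym in conn_e *.
by apply: connect1; apply/exists_inP; exists f.
Qed.

(* Merging the [A]-components into [B]-components is onto, so it is injective
   when the numbers of components agree. *)
Lemma ncompS_strict (G : mgraph) (A B : {set edge G}) (u v : vertex G) :
  A \subset B -> connect (adj B) u v -> ~~ connect (adj A) u v ->
  (ncomp B < ncomp A)%N.
Proof.
move=> AB Buv NAuv.
pose f (K : {set vertex G}) := \bigcup_(z in K) component B z.
have fE z : f (component A z) = component B z.
  apply/setP => t; apply/bigcupP/idP => [[s]|tz].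
    rewrite !inE => /(connect_adjS AB); exact: connect_trans.
  by exists z; rewrite // inE connect0.
have BE : components B = f @: components A.
  rewrite /components -imset_comp; apply: eq_imset => z /=.
  by rewrite fE.
rewrite /ncomp BE ltn_neqAle leq_imset_card andbT.
apply/negP => /imset_injP inj_f; case/negP: NAuv.
rewrite -component_eqE; apply/eqP; apply: inj_f; try exact: component_in.
by rewrite !fE; apply/eqP; rewrite component_eqE.
Qed.

(** The witness [e] becomes a loop in [contract A]. If its ends were disconnected in [A], adding [e]
    would lower the component count. *)
Lemma nflatP (G : mgraph) (A : {set edge G}) :
  ~~ flat A ->
  exists2 e, e \notin A & connect (adj A) (ends e).1 (ends e).2.
Proof.
case/forallPn => e; rewrite negb_imply => /andP[eA lt_e]; exists e => //.
apply: contraNT lt_e; apply: ncompS_strict; first exact: subsetUr.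
by apply: connect1; apply: adj_ends; rewrite setU11.
Qed.

(** * Contraction *)

Lemma component_vertex_eqE (G : mgraph) (A : {set edge G}) (u v : vertex G) :
  (component_vertex A u == component_vertex A v) = connect (adj A) u v.
Proof. by rewrite -val_eqE /= component_eqE. Qed.

Lemma component_vertex_onto (G : mgraph) (A : {set edge G})
    (K : vertex (contract A)) : exists v, component_vertex A v = K.
Proof. by have /imsetP[v _ E] := valP K; exists v; apply: val_inj. Qed.

(** From right to left, an edge of [A] collapses to a point and any other edge is one of [S]. From
    left to right, equality of vertices of [contract A] means connection through [A], so each step
    lifts to an [A]-path, an edge of [S] in either direction, and another [A]-path. *)
Lemma connect_contract (G : mgraph) (A : {set edge G})
    (S : {set edge (contract A)}) (u v : vertex G) :
  connect (@adj (contract A) S) (component_vertex A u) (component_vertex A v)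
  = connect (adj (A :|: val @: S)) u v.
Proof.
apply/idP/idP; last first.
  case/connectP => p; elim: p u => [|z p IHp] u /=; first by move=> _ ->.
  case/andP=> uz /IHp{}IHp /IHp; apply: connect_trans.
  case/exists_inP: uz => e; rewrite inE => /orP[eA | /imsetP[f fS ->]] E.
    rewrite (_ : component_vertex A u = component_vertex A z) //.
    apply/eqP; rewrite component_vertex_eqE; apply: connect1.
    by apply/exists_inP; exists e.
  apply: connect1; apply/exists_inP; exists f => //=.
  by case/orP: E => /eqP-> /=; rewrite eqxx ?orbT.
have lift s t : component_vertex A s = component_vertex A t ->
    connect (adj (A :|: val @: S)) s t.
  by move/eqP; rewrite component_vertex_eqE; apply/connect_adjS/subsetUl.
case/connectP => p; elim: p u => [|K p IHp] u /=.
  by move=> _ /esym /lift.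
have [z <-] := component_vertex_onto _ _ K.
case/andP=> uz /IHp{}IHp /IHp; apply: connect_trans.
case/exists_inP: uz => e eS /= E.
have : adj (A :|: val @: S) (ends (val e)).1 (ends (val e)).2.
  by apply: adj_ends; rewrite inE imset_f ?orbT.
move/connect1 => eE; case/orP: E => /eqP E;
  have /lift e1 := congr1 fst E; have /lift e2 := congr1 snd E.
  rewrite connect_adj_sym in e1.
  exact: connect_trans e1 (connect_trans eE e2).
rewrite connect_adj_sym in e2; rewrite connect_adj_sym in eE.
exact: connect_trans e2 (connect_trans eE e1).
Qed.

(** Preimage under [component_vertex A] sends components to components; it is injective because that
    map is onto. *)
Lemma ncomp_contract (G : mgraph) (A : {set edge G})
    (S : {set edge (contract A)}) :
  @ncomp (contract A) S = ncomp (A :|: val @: S).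
Proof.
pose pre (K : {set vertex (contract A)}) := component_vertex A @^-1: K.
have preE v : pre (@component (contract A) S (component_vertex A v))
    = component (A :|: val @: S) v.
  by apply/setP => u; rewrite !inE connect_contract.
have -> : ncomp (A :|: val @: S) = #|pre @: @components (contract A) S|.
  rewrite /ncomp; congr #|pred_of_set _|; apply/setP => K.
  apply/imsetP/imsetP => [[v _ ->]|[_ /imsetP[L _ ->] ->]].
    by exists (@component (contract A) S (component_vertex A v));
      rewrite ?preE ?component_in.
  by have [v <-] := component_vertex_onto _ _ L; exists v.
rewrite card_in_imset // => K L _ _ /setP KL; apply/setP => M.
by have [v <-] := component_vertex_onto _ _ M; have := KL v; rewrite !inE.
Qed.

Lemma sum_contract (V : nmodType) (G : mgraph) (A : {set edge G})
    (f : {set edge G} -> V) :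
  \sum_(T : {set edge G} | A \subset T) f T =
  \sum_(S : {set edge (contract A)}) f (A :|: val @: S).
Proof.
(* The inverse of [S] |-> [A :|: val @: S] on the supersets of [A]. *)
pose res (T : {set edge G}) : {set edge (contract A)} :=
  [set e | (val e : edge G) \in T].
rewrite (reindex_onto (fun S : {set edge (contract A)} => A :|: val @: S) res).
  apply: eq_bigl => S; rewrite subsetUl /=; apply/eqP/setP => e.
  by rewrite !inE (negbTE (valP e)) mem_imset //; apply: val_inj.
move=> T AT; apply/setP => e; rewrite inE.
case: (boolP (e \in A)) => [/(subsetP AT)->|eA] //=.
apply/imsetP/idP => [[e']|eT]; first by rewrite inE => eT ->.
by exists (Sub e eA); rewrite ?inE.
Qed.

(** * Subset expansions of the chromatic and bad coloring polynomials *)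

Section PolynomialIdentities.
Variable F : fieldType.

Lemma chromatic_contract (G : mgraph) (A : {set edge G}) (x : F) :
  chromatic (contract A) x =
  \sum_(T : {set edge G} | A \subset T) (-1) ^+ #|T :\: A| * x ^+ ncomp T.
Proof.
rewrite sum_contract; apply: eq_bigr => S _; rewrite ncomp_contract.
rewrite setDUl setDv set0U (_ : _ :\: A = val @: S) ?card_imset //.
  exact: val_inj.
by apply/setDidPl; rewrite disjoint_subset; apply/subsetP => _ /imsetP[e _ ->];
  rewrite inE (valP e).
Qed.

(** Toggling the edge [e] from [nflatP] in the supersets of [A] keeps [ncomp] and flips the sign, so
    the terms cancel in pairs. *)
Lemma chromatic_contract_nflat (G : mgraph) (A : {set edge G}) (x : F) :
  ~~ flat A -> chromatic (contract A) x = 0.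
Proof.
case/nflatP => e eA conn_e; rewrite chromatic_contract.
rewrite (bigID (fun T : {set edge G} => e \in T)) /=.
rewrite (reindex_onto (fun T => e |: T) (fun T => T :\ e)) /=; last first.
  by move=> T /andP[_ eT]; rewrite setD1K.
rewrite (eq_bigl (fun T : {set edge G} => (A \subset T) && (e \notin T))).
  rewrite -big_split big1 //= => T /andP[AT eT].
  rewrite ncompU1_connected; last exact: connect_adjS conn_e.
  rewrite (_ : (e |: T) :\: A = e |: (T :\: A)); last first.
    by apply/setP => f; rewrite !inE; case: eqP => // ->; rewrite eA.
  by rewrite cardsU1 !inE (negbTE eT) andbF exprD expr1 mulN1r mulNr addNr.
(* The reindexing condition [(e |: T) :\ e == T] says exactly that [e] is not in [T]. *)
move=> T; rewrite setU11 andbT; case: (boolP (e \in T)) => eT.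
  rewrite andbF; apply/negbTE; rewrite negb_and orbC; apply/orP; left.
  by apply: contraTneq eT => <-; rewrite !inE eqxx.
by rewrite setU1K // eqxx !andbT -[in RHS](setU1K eT) subsetD1 eA andbT.
Qed.

Lemma prodrD_subset (I : finType) (R : {set I}) (f g : I -> F) :
  \prod_(i in R) (f i + g i) =
  \sum_(T : {set I} | T \subset R)
    \prod_(i in T) f i * \prod_(i in R :\: T) g i.
Proof.
rewrite big_mkcond /=.
(* Outside [R] the factor 1 is split as 0 + 1: the 0 kills every subset not inside [R], and the 1 is
   neutral in the complementary product. *)
rewrite (eq_bigr (fun i => (if i \in R then f i else 0)
                           + (if i \in R then g i else 1))); last first.
  by move=> i _; case: ifP; rewrite ?add0r.
rewrite bigA_distr (bigID (fun T : {set I} => T \subset R)) /=.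
rewrite [X in _ + X]big1 ?addr0 => [|T /subsetPn[i iT iR]]; last first.
  by rewrite (bigD1 i) //= iT (negbTE iR) mul0r.
apply: eq_bigr => T TR.
rewrite (bigID (mem T)) /=; congr (_ * _).
  by apply: eq_bigr => i iT; rewrite iT (subsetP TR).
rewrite big_mkcond [RHS]big_mkcond; apply: eq_bigr => i _.
by rewrite !inE; case: (i \in T).
Qed.

Lemma bad_coloringE (G : mgraph) (x : F) (y : edge G -> F) :
  bad_coloring x y =
  \sum_(T : {set edge G}) x ^+ ncomp T * \prod_(e in T) (y e - 1).
Proof.
transitivity (\sum_(A : {set edge G})
                chromatic (contract A) x * \prod_(e in A) y e).
  rewrite [RHS](bigID (@flat G)) /= [X in _ + X]big1 ?addr0 // => A nfA.
  by rewrite chromatic_contract_nflat ?mul0r.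
under eq_bigr => A _ do rewrite chromatic_contract mulr_suml.
(* For fixed [T], the sum over [A] inside [T] is the expansion of the product of [y e + (-1)]. *)
rewrite (exchange_big_dep xpredT) //=; apply: eq_bigr => T _.
rewrite prodrD_subset mulr_sumr; apply: eq_bigr => A _.
by rewrite prodr_const mulrAC [RHS]mulrC; congr (_ * _); apply: mulrC.
Qed.

End PolynomialIdentities.

(** * Dividends of unanimity, augmented and product games *)

Section Dividends.
Variable F : fieldType.

Lemma dividendE (N : finType) (v : {set N} -> F) (R : {set N}) :
  dividend v R =
  \sum_(T : {set N} | T \subset R) (-1) ^+ #|R :\: T| * v T.
Proof. by apply: eq_bigr => T TR; rewrite cardsDS. Qed.

Lemma dividend_unanimity (N : finType) (Q R : {set N}) :
  dividend (fun S => (Q \subset S)%:R : F) R = (Q == R)%:R.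
Proof.
rewrite dividendE; case: (boolP (Q \subset R)) => QR; last first.
  rewrite (_ : (Q == R) = false); last by apply: contraNF QR => /eqP->.
  rewrite big1 // => T TR; rewrite (_ : (Q \subset T) = false) ?mulr0 //.
  by apply: contraNF QR => /subset_trans->.
(* In the expansion of this product the term of [T] vanishes unless [R :\: T] misses [Q], which for
   [Q] inside [R] means that [T] contains [Q]. The product itself has a zero factor as soon as [R]
   leaves [Q]. *)
transitivity (\prod_(i in R) (1 + - (i \notin Q)%:R) : F).
  rewrite prodrD_subset; apply: eq_bigr => T TR.
  rewrite big1 // mul1r; case: (boolP (Q \subset T)) => QT.
    rewrite mulr1 -prodr_const; apply: eq_bigr => i; rewrite inE.
    case/andP=> iT _; rewrite (_ : i \notin Q) //.
    by apply: contra iT => /(subsetP QT).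
  case/subsetPn: QT => i iQ iT; rewrite (bigD1 i) ?inE ?iT ?(subsetP QR) //=.
  by rewrite iQ oppr0 mul0r mulr0.
rewrite eqEsubset QR /=; case: (boolP (R \subset Q)) => RQ.
  by rewrite big1 // => i /(subsetP RQ) ->; rewrite subr0.
by case/subsetPn: RQ => i iR iQ; rewrite (bigD1 i) //= iQ subrr mul0r.
Qed.

(** The basic game of [Q] is a multiple of the unanimity game of [Q], so only the summand [Q = R]
    contributes to the dividend at [R]. *)
Lemma dividend_augmented_game (G : mgraph) (x : F) (w : {set edge G} -> F)
    (R : {set edge G}) : R != set0 ->
  dividend (augmented_game x w) R = dividend w R * (#|R|%:R * x ^+ ncomp R).
Proof.
move=> R0; rewrite dividendE.
under eq_bigr => T _ do rewrite mulr_sumr.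
rewrite exchange_big /= (bigD1 R) //= [X in _ + X]big1 ?addr0 => [|Q].
  rewrite (bigD1 R) //= big1 => [|T /andP[TR nTR]]; last first.
    rewrite /basic_augmented_game ifF ?mulr0 //.
    by apply: contraNF nTR => RT; rewrite eqEsubset TR.
  by rewrite setDv cards0 mul1r addr0 /basic_augmented_game subxx.
case/andP=> _ QR.
transitivity (dividend w Q * (#|Q|%:R * x ^+ ncomp Q)
              * dividend (fun S => (Q \subset S)%:R : F) R).
  rewrite [dividend _ R]dividendE mulr_sumr; apply: eq_bigr => T _.
  rewrite /basic_augmented_game; case: ifP => _.
    by rewrite mulr1; apply: mulrC.
  by rewrite !mulr0.
by rewrite dividend_unanimity (negbTE QR) mulr0.
Qed.

(** The correction [(-1) ^+ #|R|] is the term of the empty set: the empty product is 1, while a game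
    takes the value 0 there. *)
Lemma dividend_product_game (N : finType) (v : {set N} -> F) (y : N -> F)
    (R : {set N}) :
  v set0 = 0 -> (forall A, A != set0 -> v A = \prod_(e in A) y e) ->
  dividend v R = \prod_(e in R) (y e - 1) - (-1) ^+ #|R|.
Proof.
move=> v0 vE; rewrite prodrD_subset dividendE.
rewrite (bigD1 set0) ?sub0set //= [in RHS](bigD1 set0) ?sub0set //=.
rewrite v0 mulr0 add0r big_set0 mul1r setD0 prodr_const addrAC subrr add0r.
apply: eq_bigr => T /andP[_ T0].
by rewrite vE // prodr_const mulrC.
Qed.

End Dividends.

(** * The Shapley value *)

Lemma shapley_product_game (F : numFieldType) (G : mgraph) (x : F)
    (v : {set edge G} -> F) (y : edge G -> F) (a : edge G) :
  v set0 = 0 -> (forall A, A != set0 -> v A = \prod_(e in A) y e) ->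
  shapley (augmented_game x v) a =
  (y a - 1) * bad_coloring x (fun e : edge (contract [set a]) => y (val e))
  + chromatic (contract [set a]) x.
Proof.
move=> v0 vE; rewrite bad_coloringE chromatic_contract sum_contract.
rewrite mulr_sumr -big_split /=.
transitivity (\sum_(R : {set edge G} | [set a] \subset R)
    x ^+ ncomp R * (\prod_(e in R) (y e - 1) - (-1) ^+ #|R|)).
  apply: eq_big => [R|R aR]; first by rewrite sub1set.
  have R0 : R != set0 by apply/set0Pn; exists a.
  rewrite dividend_augmented_game // (dividend_product_game _ _ _ y) //.
  (* The Shapley weight cancels the factor [#|R|] of the basic game; this uses that [#|R|] is
     nonzero in characteristic 0. *)
  rewrite mulrCA mulKf 1?mulrC // pnatr_eq0 cards_eq0 //.
rewrite sum_contract; apply: eq_bigr => S _.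
have aS : a \notin [set val e | e in S].
  by apply/imsetP => -[e _ E]; have := valP e; rewrite /= -E set11.
rewrite ncomp_contract big_setU1 //= big_imset /=; last first.
  by move=> e f _ _; apply: val_inj.
(* The extra edge [a] contributes one more sign, which turns the subtracted power of -1 into the
   positive term of the chromatic polynomial. *)
rewrite cardsU1 aS exprS mulN1r opprK setU1K // mulrDr.
by congr (_ + _); [rewrite mulrCA | rewrite mulrC].
Qed.

Theorem theorem12 (R : realType) (G : mgraph) (x : R[i])
    (w : {set edge G} -> rat)
    (w_ge0 : forall A : {set edge G}, 0 <= w A)
    (w_set0 : w set0 = 0)
    (w_couple : forall A : {set edge G}, A != set0 ->
       w A = \prod_(e in A) w [set e])
    (a : edge G) :
  shapley (augmented_game x (fun S : {set edge G} => ratr (w S))) a =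
    (ratr (w [set a]) - 1) *
      bad_coloring x
        (fun e : edge (contract [set a]) => ratr (w [set (val e : edge G)]))
    + chromatic (contract [set a]) x.
Proof.
(* The couple condition passes to [R[i]] because [ratr] is a ring morphism. *)
apply: (shapley_product_game _ _ x (fun S => ratr (w S))
          (fun e => ratr (w [set e]))) => [|A A0]; first by rewrite w_set0 rmorph0.
by rewrite w_couple // rmorph_prod.
Qed.
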